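(* Let $F(x,y,z,w)=\sum_{n\ge0}\sum_{\pi\in\mathbf I_n(3412)}x^ny^{\mathrm{inv}(\pi)}z^{\mathrm{des}(\pi)}w^{\mathrm{fix}(\pi)}$. Then $$F(x,y,z,w)=\frac{1}{1-xw-x^2yz+x^2yz^2-x^2yz^2F(xy^2,y,z,w)}=\cfrac{1}{1+b_0-\cfrac{c_0}{1+b_1-\cfrac{c_1}{1+b_2-\cfrac{c_2}{1+\cdots}}}}$$ where $b_i=-xy^{2i}w-x^2y^{4i+1}z+x^2y^{4i+1}z^2$ and $c_i=x^2y^{4i+1}z^2$ for $i\ge0$.
   Context: $\mathbf I_n(3412)$ is the set of involutions of $\{1,\dots,n\}$ with no subsequence order-isomorphic to $3412$ ($\mathbf I_0$ contains the empty involution). $\mathrm{inv}(\pi)$ is the number of pairs $i<j$ with $\pi_i>\pi_j$, $\mathrm{des}(\pi)$ the number of $i$ with $\pi_i>\pi_{i+1}$, $\mathrm{fix}(\pi)$ the number of fixed points. *)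

(* Defs.v *)
From HB Require Import structures.
From mathcomp Require Import all_boot all_order all_algebra all_fingroup.
From mathcomp Require Import boolp.
From mathcomp Require Import mpoly.

Set Implicit Arguments.
Unset Strict Implicit.
Unset Printing Implicit Defensive.

Import GRing.Theory.
Local Open Scope ring_scope.

(* Formal power series in one variable: fps R is R[[x]], with the Cauchy
   product; the units are the series whose constant coefficient is a unit.
   As everywhere in ssralg, f^-1 = f when f is not a unit. *)

Record fps (R : Type) := Fps { fps_coef : nat -> R }.

HB.instance Definition _ (R : Type) := gen_eqMixin (fps R).
HB.instance Definition _ (R : Type) := gen_choiceMixin (fps R).

Lemma fpsP (R : Type) (f g : fps R) : fps_coef f =1 fps_coef g <-> f = g.
Proof.
split=> [|-> //]; case: f g => [f] [g] /= fg.
by congr Fps; apply: functional_extensionality_dep.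
Qed.

Section FpsZmod.
Context (R : zmodType).
Implicit Types f g h : fps R.

Definition fps_zero : fps R := Fps (fun=> 0).
Definition fps_opp f : fps R := Fps (fun n => - fps_coef f n).
Definition fps_add f g : fps R := Fps (fun n => fps_coef f n + fps_coef g n).

Fact fps_addA : associative fps_add.
Proof. by move=> f g h; apply/fpsP => n; rewrite /= addrA. Qed.
Fact fps_addC : commutative fps_add.
Proof. by move=> f g; apply/fpsP => n; rewrite /= addrC. Qed.
Fact fps_add0 : left_id fps_zero fps_add.
Proof. by move=> f; apply/fpsP => n; rewrite /= add0r. Qed.
Fact fps_addN : left_inverse fps_zero fps_opp fps_add.
Proof. by move=> f; apply/fpsP => n; rewrite /= addNr. Qed.

HB.instance Definition _ :=
  GRing.isZmodule.Build (fps R) fps_addA fps_addC fps_add0 fps_addN.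
End FpsZmod.

Section FpsRing.
Context (R : comNzRingType).
Implicit Types f g h : fps R.

Definition fpsC (a : R) : fps R := Fps (fun n => if n == 0%N then a else 0).
Definition fpsX : fps R := Fps (fun n => (n == 1%N)%:R).
Definition fps_mul f g : fps R :=
  Fps (fun n => \sum_(i < n.+1) fps_coef f i * fps_coef g (n - i)%N).

Fact fps_mulC : commutative fps_mul.
Proof.
move=> f g; apply/fpsP => n /=; rewrite (reindex_inj rev_ord_inj) /=.
by apply: eq_bigr => i _; rewrite mulrC subSS subKn // -ltnS ltn_ord.
Qed.

Fact fps_mulA : associative fps_mul.
Proof.
have coef_rev f g n : fps_coef (fps_mul f g) n =
    \sum_(i < n.+1) fps_coef f (n - i)%N * fps_coef g i.
  by rewrite fps_mulC; apply: eq_bigr => i _; rewrite mulrC.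
move=> f g h; apply/fpsP => i; rewrite [RHS]coef_rev /=.
pose coef3 j k := fps_coef f j * (fps_coef g (i - j - k)%N * fps_coef h k).
transitivity (\sum_(j < i.+1) \sum_(k < i.+1 | (k <= i - j)%N) coef3 j k).
  apply: eq_bigr => /= j _.
  rewrite -[X in _ * X]/(fps_coef (fps_mul g h) (i - j)) coef_rev big_distrr /=.
  by rewrite (big_ord_narrow_leq (leq_subr _ _)).
rewrite (exchange_big_dep predT) //=; apply: eq_bigr => k _.
transitivity (\sum_(j < i.+1 | (j <= i - k)%N) coef3 j k).
  apply: eq_bigl => j; rewrite -ltnS -(ltnS j) -!subSn ?leq_ord //.
  by rewrite -subn_gt0 -(subn_gt0 j) -!subnDA addnC.
rewrite (big_ord_narrow_leq (leq_subr _ _)) big_distrl /=.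
by apply: eq_bigr => j _; rewrite /coef3 -!subnDA addnC mulrA.
Qed.

Fact fps_mul1 : left_id (fpsC 1) fps_mul.
Proof.
move=> f; apply/fpsP => n; rewrite /= big_ord_recl /= mul1r subn0 big1 ?addr0 //.
by move=> i _; rewrite mul0r.
Qed.

Fact fps_mulDl : left_distributive fps_mul (@fps_add R).
Proof.
move=> f g h; apply/fpsP => n; rewrite /= -big_split /=.
by apply: eq_bigr => i _; rewrite mulrDl.
Qed.

Fact fps_one_neq0 : fpsC 1 != 0 :> fps R.
Proof.
apply/eqP => /fpsP/(_ 0%N) /= e; by move: (oner_neq0 R); rewrite e eqxx.
Qed.

HB.instance Definition _ := GRing.Zmodule_isComNzRing.Build (fps R)
  fps_mulA fps_mulC fps_mul1 fps_mulDl fps_one_neq0.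

Lemma fps_coefM f g n :
  fps_coef (f * g) n = \sum_(i < n.+1) fps_coef f i * fps_coef g (n - i)%N.
Proof. by []. Qed.

(* The composite f(g), meaningful when g has constant coefficient 0: then g^k
   has no term of degree < k, so the sum over k may be cut at k = n. *)
Definition fps_comp f g : fps R :=
  Fps (fun n => \sum_(k < n.+1) fps_coef f k * fps_coef (g ^+ k) n).

(* Convergence for the x-adic topology (with R discrete). *)
Definition fps_cvg (u : nat -> fps R) f : Prop :=
  forall n, exists M, forall m, (M <= m)%N -> fps_coef (u m) n = fps_coef f n.
End FpsRing.

Section FpsUnit.
Context (R : comUnitRingType).
Implicit Types f g h : fps R.

Definition fps_unit : {pred fps R} :=
  fun f => fps_coef f 0 \is a GRing.unit.

(* The coefficients of degree < n of the inverse. *)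
Fixpoint fps_invs f (n : nat) : seq R :=
  if n is m.+1 then
    let s := fps_invs f m in
    rcons s ((fps_coef f 0)^-1 *
      ((m == 0%N)%:R - \sum_(i < m) s`_i * fps_coef f (m - i)%N))
  else [::].

Definition fps_inv f : fps R :=
  if f \in fps_unit then Fps (fun n => (fps_invs f n.+1)`_n) else f.

Lemma size_fps_invs f n : size (fps_invs f n) = n.
Proof. by elim: n => //= n IHn; rewrite size_rcons IHn. Qed.

Lemma nth_fps_invs f n i : (i < n)%N -> (fps_invs f n)`_i = (fps_invs f i.+1)`_i.
Proof.
elim: n => // n IHn; rewrite ltnS leq_eqVlt => /orP[/eqP-> //|lt_in].
by rewrite [in LHS]/= nth_rcons size_fps_invs lt_in IHn.
Qed.

Fact fps_mulV : {in fps_unit, left_inverse 1 fps_inv *%R}.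
Proof.
move=> f fU; apply/fpsP => n; rewrite fps_coefM /fps_inv fU.
rewrite big_ord_recr /= subnn nth_rcons size_fps_invs ltnn eqxx.
rewrite mulrAC mulVr // mul1r.
under eq_bigr => i _ do rewrite -[rcons _ _]/(fps_invs f i.+1) -(nth_fps_invs f (ltn_ord i)).
by rewrite addrC subrK; case: n => [|n].
Qed.

Fact fps_unitPl f g : g * f = 1 -> fps_unit f.
Proof.
move/fpsP/(_ 0%N); rewrite fps_coefM big_ord1 /= => gf1.
by apply/unitrPr; exists (fps_coef g 0); rewrite mulrC.
Qed.

Fact fps_inv_out : {in [predC fps_unit], fps_inv =1 id}.
Proof. by move=> f; rewrite inE /= /fps_inv => /negbTE ->. Qed.

HB.instance Definition _ := GRing.ComNzRing_hasMulInverse.Build (fps R)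
  fps_mulV fps_unitPl fps_inv_out.

Lemma fps_unitE f :
  (f \is a GRing.unit) = (fps_coef f 0 \is a GRing.unit).
Proof. by []. Qed.

(* The denominator
     1 + b_i - c_i / (1 + b_{i+1} - c_{i+1} / ( ... / (1 + b_{i+m}))). *)
Fixpoint cfrac_den (b c : nat -> fps R) (m i : nat) : fps R :=
  if m is m'.+1 then 1 + b i - c i / cfrac_den b c m' i.+1 else 1 + b i.

(* f = 1/(1 + b_0 - c_0/(1 + b_1 - c_1/(1 + b_2 - ...))): every denominator of
   every convergent is invertible and the convergents tend to f. *)
Definition is_cfrac (b c : nat -> fps R) f : Prop :=
  (forall m i, cfrac_den b c m i \is a GRing.unit) /\
  fps_cvg (fun m => 1 / cfrac_den b c m 0) f.
End FpsUnit.

(* Permutations of {1, ..., n} are 'S_n, with 'I_n = {0, ..., n-1}. *)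

Definition involution n (s : 'S_n) : bool := [forall i, s (s i) == i].

(* s has a subsequence s_(f 0), s_(f 1), ... (f increasing) which is
   order-isomorphic to the word p. *)
Definition contains (p : seq nat) n (s : 'S_n) : bool :=
  [exists f : {ffun 'I_(size p) -> 'I_n},
    [forall a : 'I_(size p), forall b : 'I_(size p),
      ((a < b)%N ==> (f a < f b)%N) &&
      ((s (f a) < s (f b))%N == (nth 0 p a < nth 0 p b)%N)]].

Definition I3412 n : {set 'S_n} :=
  [set s : 'S_n | involution s && ~~ contains [:: 3; 4; 1; 2]%N s].

Definition inv n (s : 'S_n) : nat :=
  #|[set ij : 'I_n * 'I_n | (ij.1 < ij.2)%N && (s ij.2 < s ij.1)%N]|.

Definition des n (s : 'S_n) : nat :=
  #|[set i : 'I_n | [exists j : 'I_n, (j == i.+1 :> nat) && (s j < s i)%N]]|.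

Definition fixpts n (s : 'S_n) : nat := #|[set i : 'I_n | s i == i]|.

(* Generating functions live in Z[y,z,w][[x]]. *)
Notation Zyzw := {mpoly int[3]}.

Definition ypol : Zyzw := 'X_(inord 0).
Definition zpol : Zyzw := 'X_(inord 1).
Definition wpol : Zyzw := 'X_(inord 2).

Definition x : fps Zyzw := fpsX Zyzw.
Definition y : fps Zyzw := fpsC ypol.
Definition z : fps Zyzw := fpsC zpol.
Definition w : fps Zyzw := fpsC wpol.

Definition F : fps Zyzw :=
  Fps (fun n => \sum_(s in I3412 n)
    ypol ^+ inv s * zpol ^+ des s * wpol ^+ fixpts s).

Definition b_ (i : nat) : fps Zyzw :=
  - (x * y ^+ (2 * i)%N * w) - x ^+ 2 * y ^+ (4 * i + 1)%N * z
  + x ^+ 2 * y ^+ (4 * i + 1)%N * z ^+ 2.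

Definition c_ (i : nat) : fps Zyzw := x ^+ 2 * y ^+ (4 * i + 1)%N * z ^+ 2.

(* Main.v *)
(** An involution of [{0, ..., n-1}] is handled as the word [u] of its values.
    If it avoids 3412 and exchanges [0] and [a], then [{0, ..., a}] is stable,
    so the word splits uniquely as a direct sum [b (+) v], where [b] is either a
    fixed point or a 3412-avoiding involution [u'] of size [m] enclosed by the
    transposition of its two end points. Enclosing adds [2m + 1] inversions and
    1 or 2 descents according to whether [m = 0], while all three statistics are
    additive over [(+)]. Hence [F = 1 + B F] with
    [B = xw + x^2 y (z + z^2 (F(x y^2) - 1))], which is the functional equation.
    Substituting [x y^(2i)] for [x] makes the [F(x y^(2i))] the successive tails
    of the continued fraction; they are its limits because each level multiplies
    the error by [x^2]. *)

Require Import Defs.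
From HB Require Import structures.
From mathcomp Require Import all_boot all_algebra all_fingroup.
From mathcomp Require Import mpoly zify ring.

Set Implicit Arguments.
Unset Strict Implicit.
Unset Printing Implicit Defensive.

Import GRing.Theory.

(** * Direct sums and enclosures of words *)

Definition endo_word (u : seq nat) : bool := all (gtn (size u)) u.

Definition involutive_word (u : seq nat) : Prop :=
  endo_word u /\ forall i, i < size u -> nth 0 u (nth 0 u i) = i.

Definition oplus (u v : seq nat) : seq nat := u ++ map (addn (size u)) v.

Definition enclose (u : seq nat) : seq nat := (size u).+1 :: rcons (map S u) 0.

Lemma endo_wordP (u : seq nat) :
  reflect (forall i, i < size u -> nth 0 u i < size u) (endo_word u).
Proof. exact: all_nthP. Qed.

Lemma size_oplus (u v : seq nat) : size (oplus u v) = size u + size v.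
Proof. by rewrite size_cat size_map. Qed.

Lemma size_enclose (u : seq nat) : size (enclose u) = (size u).+2.
Proof. by rewrite /= size_rcons size_map. Qed.

Lemma nth_oplusl (u v : seq nat) i :
  i < size u -> nth 0 (oplus u v) i = nth 0 u i.
Proof. by move=> lt_iu; rewrite nth_cat lt_iu. Qed.

Lemma nth_oplusr (u v : seq nat) i :
  i < size v -> nth 0 (oplus u v) (size u + i) = size u + nth 0 v i.
Proof.
by move=> lt_iv; rewrite nth_cat ltnNge leq_addr /= addKn (nth_map 0).
Qed.

Lemma nth_enclose (u : seq nat) i :
  i < size u -> nth 0 (enclose u) i.+1 = (nth 0 u i).+1.
Proof. by move=> lt_iu; rewrite /= nth_rcons size_map lt_iu (nth_map 0). Qed.

Lemma nth_enclose_last (u : seq nat) : nth 0 (enclose u) (size u).+1 = 0.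
Proof. by rewrite /= nth_rcons size_map ltnn eqxx. Qed.

Lemma oplus_inj (b c u v : seq nat) :
  size b = size c -> oplus b u = oplus c v -> b = c /\ u = v.
Proof.
move=> eq_bc /eqP; rewrite /oplus eqseq_cat // => /andP[/eqP-> /eqP].
by move/(inj_map (@addnI _)).
Qed.

Lemma enclose_inj : injective enclose.
Proof. by move=> u v [_ /rcons_inj[/inj_map-> //]]; apply: succn_inj. Qed.

Lemma enclose_le (u : seq nat) i :
  endo_word u -> nth 0 (enclose u) i <= (size u).+1.
Proof.
move=> /endo_wordP endo_u; case: i => // i.
case: (ltngtP i (size u)) => [lt_iu|lt_ui|->]; last by rewrite nth_enclose_last.
  by rewrite nth_enclose // ltnS ltnW ?endo_u.
by rewrite nth_default // size_enclose.
Qed.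

Lemma endo_oplus (u v : seq nat) :
  endo_word u -> endo_word (oplus u v) = endo_word v.
Proof.
move=> endo_u; rewrite /endo_word size_oplus all_cat all_map.
rewrite (sub_all _ endo_u) => [|a /= lt_a]; last by rewrite ltn_addr.
by apply: eq_all => a /=; rewrite ltn_add2l.
Qed.

Lemma involutive_oplus (u v : seq nat) : endo_word u ->
  involutive_word (oplus u v) <-> involutive_word u /\ involutive_word v.
Proof.
move=> endo_u; have /endo_wordP lt_u := endo_u.
rewrite /involutive_word endo_oplus // size_oplus.
split=> [[endo_v inv_uv]|[[_ inv_u] [endo_v inv_v]]];
  have /endo_wordP lt_v := endo_v; split=> //.
- split=> // i lt_i; rewrite -[LHS](nth_oplusl v) ?lt_u //.
  by rewrite -(nth_oplusl v lt_i) inv_uv ?ltn_addr.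
- split=> // i lt_i; apply: (@addnI (size u)).
  by rewrite -nth_oplusr ?lt_v // -nth_oplusr // inv_uv ?ltn_add2l.
- move=> i; case: (ltnP i (size u)) => [lt_iu _|/subnKC <-].
    by rewrite (nth_oplusl _ lt_iu) nth_oplusl ?lt_u ?inv_u.
  by rewrite ltn_add2l => lt_i; rewrite nth_oplusr // nth_oplusr ?lt_v ?inv_v.
Qed.

Lemma involutive_enclose (u : seq nat) :
  involutive_word (enclose u) <-> involutive_word u.
Proof.
split=> [[/endo_wordP lt_e inv_e]|[endo_u inv_u]].
  rewrite size_enclose in lt_e inv_e.
  have lt_u i : i < size u -> nth 0 u i < size u.
    move=> lt_iu; have := lt_e i.+1; have := inv_e i.+1; rewrite nth_enclose //.
    case: (ltngtP (nth 0 u i) (size u)) => [//||->]; first by lia.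
    by rewrite nth_enclose_last; lia.
  split=> [|i lt_iu]; first exact/endo_wordP.
  by have := inv_e i.+1; rewrite nth_enclose // nth_enclose ?lt_u //; lia.
have /endo_wordP lt_u := endo_u.
split; first by apply/endo_wordP => i _; rewrite size_enclose ltnS enclose_le.
case=> [|i]; rewrite size_enclose => lt_i; first exact: nth_enclose_last.
case: (ltnP i (size u)) => [lt_iu|le_ui].
  by rewrite !nth_enclose ?lt_u ?inv_u.
by rewrite (_ : i = size u) ?nth_enclose_last //; lia.
Qed.

Lemma involutive_exchange_ends (u : seq nat) :
    involutive_word u -> 0 < size u -> nth 0 u 0 = (size u).-1 ->
  u = [:: 0] \/ exists v, u = enclose v.
Proof.
case: u => // a t /[swap] _ /[swap] /= ->.
case/lastP: t => [|t' q]; first by left.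
rewrite size_rcons; set n := size t'; set u := _ :: _ => -[_ inv_u]; right.
have size_u : size u = n.+2 by rewrite /u /= size_rcons.
have q0 : q = 0.
  by have := inv_u 0; rewrite size_u /= nth_rcons ltnn eqxx => ->.
have t'_gt0 i : i < n -> 0 < nth 0 t' i.
  move=> lt_in; rewrite lt0n; apply/eqP => ti0.
  by have := inv_u i.+1; rewrite size_u /= nth_rcons lt_in ti0 /=; lia.
exists (map predn t'); rewrite /u q0 /enclose size_map; congr (_ :: rcons _ _).
rewrite -map_comp -[LHS]map_id; apply/eq_in_map => _ /(nthP 0)[i lt_in <-] /=.
by rewrite prednK ?t'_gt0.
Qed.

(** * Pattern occurrences *)

Definition occurrence (p u : seq nat) (f : nat -> nat) : Prop :=
  [/\ forall a, a < size p -> f a < size u,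
      forall a b, a < b < size p -> f a < f b &
      forall a b, a < size p -> b < size p ->
        (nth 0 u (f a) < nth 0 u (f b)) = (nth 0 p a < nth 0 p b)].

Definition avoids (p u : seq nat) : Prop := forall f, ~ occurrence p u f.

Lemma occurrence_trans (p u v : seq nat) f g :
  occurrence p u f -> occurrence u v g -> occurrence p v (g \o f).
Proof.
move=> [lt_f f_mono f_iso] [lt_g g_mono g_iso].
split=> [a lt_a|a b lt_ab|a b lt_a lt_b].
- by rewrite lt_g ?lt_f.
- by rewrite g_mono ?f_mono //= lt_f; case/andP: lt_ab.
- by rewrite g_iso ?lt_f ?f_iso.
Qed.

Lemma avoids_occurrence (p u v : seq nat) g :
  occurrence u v g -> avoids p v -> avoids p u.
Proof.
by move=> occ_uv av_v f occ_pu; apply: av_v (occurrence_trans occ_pu occ_uv).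
Qed.

Lemma occurrence_oplusl (u v : seq nat) : occurrence u (oplus u v) id.
Proof.
split=> [a lt_a|a b /andP[]//|a b lt_a lt_b].
  by rewrite size_oplus ltn_addr.
by rewrite !nth_oplusl.
Qed.

Lemma occurrence_oplusr (u v : seq nat) :
  occurrence v (oplus u v) (addn (size u)).
Proof.
split=> [a lt_a|a b /andP[lt_ab _]|a b lt_a lt_b].
- by rewrite size_oplus ltn_add2l.
- by rewrite ltn_add2l.
- by rewrite !nth_oplusr // ltn_add2l.
Qed.

Lemma occurrence_enclose (u : seq nat) : occurrence u (enclose u) S.
Proof.
split=> [a lt_a|a b /andP[]//|a b lt_a lt_b].
  by rewrite size_enclose ltnS ltnW.
by rewrite !nth_enclose.
Qed.

Definition sum_indecomposable (p : seq nat) : bool :=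
  all (fun k => ~~ allrel ltn (take k p) (drop k p)) (iota 1 (size p).-1).

Lemma sum_indecomposableP (p : seq nat) k :
    sum_indecomposable p -> 0 < k < size p ->
  exists a b, [/\ a < k, k <= b < size p & nth 0 p b <= nth 0 p a].
Proof.
move=> /allP/(_ k); rewrite mem_iota => ind_p lt_k.
have {ind_p} : ~~ allrel ltn (take k p) (drop k p) by apply: ind_p; lia.
have size_tk : size (take k p) = k by rewrite size_takel //; lia.
case/allPn => _ /(nthP 0)[a lt_a <-] /allPn[_ /(nthP 0)[b lt_b <-]].
rewrite size_tk size_drop nth_drop -leqNgt in lt_a lt_b *.
rewrite nth_take // => le_ba; exists a, (k + b); split=> //.
by rewrite leq_addr -ltn_subRL.
Qed.

Lemma increasing_cut (f : nat -> nat) n m :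
    (forall a b, a < b < n -> f a < f b) ->
  exists2 k, k <= n & forall a, a < n -> (f a < m) = (a < k).
Proof.
elim: n => [|n IHn] f_mono; first by exists 0.
have [a b /andP[lt_ab /ltnW lt_b]|k le_kn kP] := IHn.
  by rewrite f_mono ?lt_ab.
have [lt_fm|le_mf] := ltnP (f n) m.
  exists n.+1 => // a lt_an; rewrite lt_an.
  have [->//|neq_an] := eqVneq a n.
  by rewrite (ltn_trans _ lt_fm) ?f_mono // ltn_neqAle neq_an -ltnS lt_an /=.
exists k => [|a]; first exact: leqW.
by rewrite ltnS leq_eqVlt => /orP[/eqP->|/kP//]; lia.
Qed.

Lemma occurrence_oplus_left (p u v : seq nat) f :
    occurrence p (oplus u v) f -> (forall a, a < size p -> f a < size u) ->
  occurrence p u f.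
Proof.
move=> [_ f_mono f_iso] lt_fu; split=> // a b lt_a lt_b.
by rewrite -f_iso // !nth_oplusl ?lt_fu.
Qed.

Lemma occurrence_oplus_right (p u v : seq nat) f :
    occurrence p (oplus u v) f -> (forall a, a < size p -> size u <= f a) ->
  occurrence p v (fun a => f a - size u).
Proof.
move=> [lt_f f_mono f_iso] le_uf; rewrite size_oplus in lt_f.
have lt_fv a : a < size p -> f a - size u < size v.
  by move=> lt_a; rewrite ltn_subLR ?lt_f ?le_uf.
split=> // [a b /andP[lt_ab lt_b]|a b lt_a lt_b].
  have lt_a := ltn_trans lt_ab lt_b.
  by rewrite ltn_subLR ?subnKC ?le_uf ?f_mono ?lt_ab.
by rewrite -f_iso // -{2}(subnKC (le_uf a lt_a)) -{2}(subnKC (le_uf b lt_b))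
  !nth_oplusr ?lt_fv // ltn_add2l.
Qed.

(* An occurrence straddling [u] and [v] would cut [p] into a lower left part and
   an upper right part. *)
Lemma avoids_oplus (p u v : seq nat) : sum_indecomposable p -> endo_word u ->
  avoids p (oplus u v) <-> avoids p u /\ avoids p v.
Proof.
move=> ind_p /endo_wordP lt_u; split=> [av_uv|[av_u av_v] f occ_f].
  by split; apply: avoids_occurrence av_uv;
    [apply: occurrence_oplusl | apply: occurrence_oplusr].
have [lt_f f_mono f_iso] := occ_f; rewrite size_oplus in lt_f.
have [k le_kp kP] := increasing_cut (size u) f_mono.
have [k0|k_gt0] := posnP k.
  apply/av_v/(occurrence_oplus_right occ_f) => a /kP.
  by rewrite k0 ltnNge => /negbFE.
have [eq_kp|neq_kp] := eqVneq k (size p).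
  by apply/av_u/(occurrence_oplus_left occ_f) => a lt_a; rewrite kP // eq_kp.
have [|a [b [lt_ak /andP[le_kb lt_b] le_ba]]] := @sum_indecomposableP p k ind_p.
  by rewrite k_gt0 ltn_neqAle neq_kp.
have lt_a := leq_trans lt_ak le_kp.
have lt_fa : f a < size u by rewrite kP.
have le_fb : size u <= f b by rewrite leqNgt kP // -leqNgt.
suff : nth 0 (oplus u v) (f a) < nth 0 (oplus u v) (f b).
  by rewrite f_iso // ltnNge le_ba.
rewrite nth_oplusl // -(subnKC le_fb) nth_oplusr ?ltn_addr ?lt_u //.
by rewrite ltn_subLR ?lt_f.
Qed.

(* The end letters of [enclose u] are its maximum and its minimum, so they can
   play the role of no letter of [p]. *)
Lemma avoids_enclose (p u : seq nat) :
    has (ltn (head 0 p)) p -> has (gtn (last 0 p)) p -> endo_word u ->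
  avoids p (enclose u) <-> avoids p u.
Proof.
case/hasP=> _ /(nthP 0)[b lt_b <-] lt_hb.
case/hasP=> _ /(nthP 0)[c lt_c <-] lt_cl endo_u.
split=> [|av_u f [lt_f f_mono f_iso]].
  by apply: avoids_occurrence; apply: occurrence_enclose.
rewrite size_enclose in lt_f.
have f_gt0 a : a < size p -> 0 < f a.
  move=> lt_a; have p_gt0 : 0 < size p by apply: leq_ltn_trans lt_a.
  suff f0_gt0 : 0 < f 0.
    by case: a lt_a => // a lt_a; rewrite (ltn_trans f0_gt0) ?f_mono.
  rewrite lt0n; apply/eqP => f00; move: lt_hb; rewrite -nth0 /= -f_iso // f00.
  by rewrite ltnNge enclose_le.
have f_le a : a < size p -> f a <= size u.
  move=> lt_a; have p_gt0 : 0 < size p by apply: leq_ltn_trans lt_a.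
  have lt_l : (size p).-1 < size p by rewrite prednK.
  suff fl_le : f (size p).-1 <= size u.
    have [->//|neq_a] := eqVneq a (size p).-1.
    by rewrite (leq_trans _ fl_le) // ltnW // f_mono //; lia.
  rewrite leqNgt; apply/negP => lt_fl.
  move: lt_cl; rewrite /= -nth_last -f_iso // (_ : f _.-1 = (size u).+1).
    by rewrite nth_enclose_last.
  by have := lt_f _ lt_l; lia.
apply: (av_u (predn \o f)); split=> [a lt_a|a b' lt_ab|a b' lt_a lt_b'] /=.
- by have := f_gt0 a lt_a; have := f_le a lt_a; lia.
- by have := f_mono a b' lt_ab; have := f_gt0 a; lia.
- have fE d : d < size p -> f d = (f d).-1.+1.
    by move=> lt_d; rewrite prednK ?f_gt0.
  by rewrite -f_iso // (fE a) // (fE b') // !nth_enclose // -fE ?f_le.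
Qed.

Local Notation p3412 := [:: 3; 4; 1; 2].

Lemma occurrence3412 (u : seq nat) i j k l :
    i < j < k -> k < l < size u ->
    nth 0 u k < nth 0 u l -> nth 0 u l < nth 0 u i -> nth 0 u i < nth 0 u j ->
  occurrence p3412 u (nth 0 [:: i; j; k; l]).
Proof.
move=> ijk kl lt_kl lt_li lt_ij; split.
- by move=> [|[|[|[|a]]]] //= _; lia.
- by move=> [|[|[|[|a]]]] [|[|[|[|b]]]] //=; lia.
- by move=> [|[|[|[|a]]]] [|[|[|[|b]]]] //=; lia.
Qed.

(** * Decomposition of the 3412-avoiding involutions *)

Definition inv3412 (u : seq nat) : Prop :=
  involutive_word u /\ avoids p3412 u.

Lemma inv3412_nil : inv3412 [::].
Proof. by split=> // f [/(_ 0 isT)]. Qed.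

Lemma inv3412_seq1 : inv3412 [:: 0].
Proof.
split=> [|f [lt_f f_mono _]]; first by split=> // -[].
by have := lt_f 1 isT; have := f_mono 0 1 isT; case: (f 1).
Qed.

Lemma inv3412_oplus (u v : seq nat) :
  endo_word u -> inv3412 (oplus u v) <-> inv3412 u /\ inv3412 v.
Proof.
move=> endo_u; have := involutive_oplus v endo_u.
have := @avoids_oplus p3412 u v isT endo_u.
by rewrite /inv3412; tauto.
Qed.

Lemma inv3412_enclose (u : seq nat) : inv3412 (enclose u) <-> inv3412 u.
Proof.
have avE : endo_word u -> avoids p3412 (enclose u) <-> avoids p3412 u.
  exact: avoids_enclose.
split=> -[inv_u av_u].
  have {}inv_u : involutive_word u by apply/involutive_enclose.
  by split=> //; apply/avE => //; case: inv_u.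
by split; [apply/involutive_enclose | apply/avE => //; case: inv_u].
Qed.

(* If [u] starts with [a], then [0 < i < a < u_i] would make the letters in
   positions [0, i, a, u_i] spell 3412. *)
Lemma inv3412_first_block_stable (u : seq nat) i :
  inv3412 u -> i < size u -> (nth 0 u i <= nth 0 u 0) = (i <= nth 0 u 0).
Proof.
move=> [[/endo_wordP lt_u inv_u] av_u] lt_i.
have stable j : j < size u -> j <= nth 0 u 0 -> nth 0 u j <= nth 0 u 0.
  case: j => [|j] // lt_j; have u_gt0 : 0 < size u by apply: leq_ltn_trans lt_j.
  rewrite leq_eqVlt => /orP[/eqP eq_j|lt_ju0].
    by rewrite [X in nth 0 u X]eq_j inv_u.
  rewrite leqNgt; apply/negP => lt_u0uj.
  pose f := nth 0 [:: 0; j.+1; nth 0 u 0; nth 0 u j.+1].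
  suff /av_u : occurrence p3412 u f by [].
  by apply: occurrence3412; rewrite ?inv_u ?lt_u0uj ?lt_u.
apply/idP/idP => [le_ui|]; last exact: stable.
by rewrite -(inv_u i) // stable ?lt_u.
Qed.

Lemma inv3412_decomposition (u : seq nat) : inv3412 u -> 0 < size u ->
  exists b v, [/\ u = oplus b v, inv3412 b, inv3412 v, 0 < size b &
                  nth 0 b 0 = (size b).-1].
Proof.
move=> inv_u u_gt0; set a := nth 0 u 0.
have lt_a : a < size u by case: inv_u => -[/endo_wordP lt_u _] _; apply: lt_u.
set b := take a.+1 u; set v := [seq i - a.+1 | i <- drop a.+1 u].
have size_b : size b = a.+1 by rewrite size_takel.
have eq_u : u = oplus b v.
  rewrite -[LHS](cat_take_drop a.+1) /oplus; congr cat.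
  rewrite -map_comp -[LHS]map_id; apply/eq_in_map => _ /(nthP 0)[j lt_j <-] /=.
  rewrite size_drop in lt_j; rewrite nth_drop size_b subnKC //.
  have lt_aj : a.+1 + j < size u by rewrite -ltn_subRL.
  by rewrite ltnNge (inv3412_first_block_stable inv_u lt_aj) -ltnNge leq_addr.
have endo_b : endo_word b.
  apply/endo_wordP => i; rewrite size_b => lt_i; rewrite nth_take // ltnS.
  by rewrite (inv3412_first_block_stable inv_u) // (leq_trans lt_i).
have [inv_b inv_v] : inv3412 b /\ inv3412 v.
  by apply/inv3412_oplus; rewrite // -eq_u.
by exists b, v; split; rewrite ?size_b ?nth_take.
Qed.

(** * Statistics on words *)

Fixpoint word_inv (u : seq nat) : nat :=
  if u is a :: v then count (gtn a) v + word_inv v else 0.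

Fixpoint word_des (u : seq nat) : nat :=
  if u is a :: v then (head a v < a) + word_des v else 0.

(* The letters of [u] are in positions [k], [k + 1], ... *)
Fixpoint word_fix (k : nat) (u : seq nat) : nat :=
  if u is a :: v then (a == k) + word_fix k.+1 v else 0.

Lemma word_inv_cat (u v : seq nat) :
  allrel leq u v -> word_inv (u ++ v) = word_inv u + word_inv v.
Proof.
elim: u => //= a u IHu; rewrite allrel_consl => /andP[/allP le_av /IHu->].
rewrite count_cat addnA (_ : count (gtn a) v = 0) ?addn0 //.
apply/eqP; rewrite -leqn0 leqNgt -has_count; apply/hasPn => b /le_av /=.
by rewrite leqNgt.
Qed.

Lemma word_des_cat (u v : seq nat) :
  allrel leq u v -> word_des (u ++ v) = word_des u + word_des v.
Proof.
elim: u => //= a u IHu; rewrite allrel_consl => /andP[le_av /IHu->].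
rewrite addnA; congr (_ + _ + _); case: u {IHu} => //=; rewrite ltnn.
by case: v le_av => [|b v] /=; rewrite ?ltnn // ltnNge => /andP[->].
Qed.

Lemma word_fix_cat k (u v : seq nat) :
  word_fix k (u ++ v) = word_fix k u + word_fix (k + size u) v.
Proof.
elim: u k => [|a u IHu] k /=; first by rewrite addn0.
by rewrite IHu addnA addSnnS.
Qed.

Lemma word_inv_map (f : nat -> nat) (u : seq nat) :
  {mono f : a b / a < b} -> word_inv (map f u) = word_inv u.
Proof.
move=> f_mono; elim: u => //= a u ->; rewrite count_map; congr addn.
by apply: eq_count => b /=; rewrite f_mono.
Qed.

Lemma word_des_map (f : nat -> nat) (u : seq nat) :
  {mono f : a b / a < b} -> word_des (map f u) = word_des u.
Proof.
move=> f_mono; elim: u => //= a u ->.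
by case: u => [|b u] /=; rewrite ?ltnn ?f_mono.
Qed.

Lemma word_fix_map_addn d k (u : seq nat) :
  word_fix (d + k) (map (addn d) u) = word_fix k u.
Proof. by elim: u k => //= a u IHu k; rewrite eqn_add2l -addnS IHu. Qed.

Lemma word_inv_rcons (u : seq nat) a :
  word_inv (rcons u a) = word_inv u + count (ltn a) u.
Proof. by elim: u => //= b u ->; rewrite -cats1 count_cat /=; lia. Qed.

Lemma word_des_rcons (u : seq nat) a :
  word_des (rcons u a) = word_des u + (a < last a u).
Proof.
elim: u => [|b u IHu] /=; first by rewrite ltnn.
by rewrite IHu; case: u {IHu} => [|c u] /=; rewrite ?ltnn ?addn0 ?addnA.
Qed.

Lemma allrel_oplus (u v : seq nat) :
  endo_word u -> allrel leq u (map (addn (size u)) v).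
Proof.
move=> /allP lt_u; apply/allrelP => a _ /lt_u lt_a /mapP[c _ ->].
by rewrite (leq_trans (ltnW lt_a)) ?leq_addr.
Qed.

Lemma word_inv_oplus (u v : seq nat) :
  endo_word u -> word_inv (oplus u v) = word_inv u + word_inv v.
Proof.
move=> endo_u; rewrite word_inv_cat ?allrel_oplus // word_inv_map // => a b.
exact: ltn_add2l.
Qed.

Lemma word_des_oplus (u v : seq nat) :
  endo_word u -> word_des (oplus u v) = word_des u + word_des v.
Proof.
move=> endo_u; rewrite word_des_cat ?allrel_oplus // word_des_map // => a b.
exact: ltn_add2l.
Qed.

Lemma word_fix_oplus (u v : seq nat) :
  word_fix 0 (oplus u v) = word_fix 0 u + word_fix 0 v.
Proof.
by rewrite word_fix_cat add0n -[X in _ + word_fix X _]addn0 word_fix_map_addn.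
Qed.

Lemma word_inv_enclose (u : seq nat) :
  endo_word u -> word_inv (enclose u) = word_inv u + (2 * size u + 1).
Proof.
rewrite /endo_word all_count => /eqP lt_u.
rewrite [LHS]/= word_inv_rcons word_inv_map // -cats1 count_cat !count_map /=.
rewrite (@eq_count _ _ (gtn (size u))) // lt_u.
by rewrite (@eq_count _ _ predT) // count_predT; lia.
Qed.

Lemma word_des_enclose (u : seq nat) :
  endo_word u -> word_des (enclose u) = word_des u + (0 < size u).+1.
Proof.
move=> /allP lt_u; rewrite [LHS]/= word_des_rcons word_des_map //.
case: u lt_u => [|a u] //= lt_u; rewrite last_map ltnS.
by have /= -> := lt_u a (mem_head _ _); lia.
Qed.

Lemma word_fix_enclose (u : seq nat) : word_fix 0 (enclose u) = word_fix 0 u.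
Proof.
have shift : word_fix 1 (map S u) = word_fix 0 u := word_fix_map_addn 1 0 u.
by rewrite /= -cats1 word_fix_cat shift add1n /= !addn0.
Qed.

Lemma count_sum_nth (T : Type) (x0 : T) (P : pred T) (s : seq T) :
  count P s = \sum_(i < size s) P (nth x0 s i).
Proof. by rewrite -sumn_count sumnE big_map (big_nth x0) big_mkord. Qed.

Lemma word_invE (u : seq nat) : word_inv u =
  \sum_(i < size u) \sum_(j < size u) ((i < j) && (nth 0 u j < nth 0 u i)).
Proof.
elim: u => [|a u IHu] /=; first by rewrite big_ord0.
rewrite big_ord_recl big_ord_recl /= (count_sum_nth 0) IHu; congr addn.
by apply: eq_bigr => i _; rewrite big_ord_recl.
Qed.

Lemma word_desE (u : seq nat) : word_des u =
  \sum_(i < size u) ((i.+1 < size u) && (nth 0 u i.+1 < nth 0 u i)).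
Proof.
elim: u => [|a u IHu] /=; first by rewrite big_ord0.
rewrite big_ord_recl /= IHu; congr addn.
by case: u {IHu} => //=; rewrite ltnn.
Qed.

Lemma word_fixE k (u : seq nat) :
  word_fix k u = \sum_(i < size u) (nth 0 u i == k + i).
Proof.
elim: u k => [|a u IHu] k /=; first by rewrite big_ord0.
rewrite big_ord_recl /= IHu addn0; congr addn.
by apply: eq_bigr => i _; rewrite /bump addnS.
Qed.

(** * Words of permutations *)

Definition word n (s : 'S_n) : seq nat := [seq val (s i) | i <- enum 'I_n].

Lemma size_word n (s : 'S_n) : size (word s) = n.
Proof. by rewrite size_map size_enum_ord. Qed.

Lemma nth_word n (s : 'S_n) (i : 'I_n) : nth 0 (word s) i = s i.
Proof. by rewrite (nth_map i) ?size_enum_ord // nth_ord_enum. Qed.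

Lemma word_inj n : injective (@word n).
Proof.
move=> s t eq_st; apply/permP => i; apply: val_inj.
by rewrite /= -!nth_word eq_st.
Qed.

Lemma card_set_sum (T : finType) (P : pred T) : #|[set i | P i]| = \sum_i P i.
Proof.
by rewrite -sum1dep_card big_mkcond; apply: eq_bigr => i _; case: (P i).
Qed.

Lemma word_inv_word n (s : 'S_n) : word_inv (word s) = Defs.inv s.
Proof.
rewrite /Defs.inv card_set_sum word_invE size_word pair_bigA /=.
by apply: eq_bigr => -[i j] _; rewrite !nth_word.
Qed.

Lemma word_des_word n (s : 'S_n) : word_des (word s) = des s.
Proof.
rewrite /des card_set_sum word_desE size_word; apply: eq_bigr => i _.
congr nat_of_bool.
apply/andP/existsP => [[lt_i desc_i]|[j /andP[/eqP<- desc_i]]].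
  exists (Ordinal lt_i); rewrite eqxx /=.
  by move: desc_i; rewrite nth_word -[i.+1]/(val (Ordinal lt_i)) nth_word.
by rewrite ltn_ord !nth_word.
Qed.

Lemma word_fix_word n (s : 'S_n) : word_fix 0 (word s) = fixpts s.
Proof.
rewrite /fixpts card_set_sum word_fixE size_word; apply: eq_bigr => i _.
by rewrite nth_word.
Qed.

Lemma containsP (p : seq nat) n (s : 'S_n) :
  reflect (exists f, occurrence p (word s) f) (contains p s).
Proof.
apply: (iffP existsP) => [[f /forallP occ_f]|[f [lt_f f_mono f_iso]]].
  have occ (a b : 'I_(size p)) : (a < b -> f a < f b) /\
      (s (f a) < s (f b)) = (nth 0 p a < nth 0 p b).
    by have /forallP/(_ b)/andP[/implyP f_mono /eqP] := occ_f a.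
  exists (fun a => if insub a is Some i then val (f i) else 0).
  split=> [a lt_a|a b /andP[lt_ab lt_b]|a b lt_a lt_b].
  - by rewrite insubT size_word ltn_ord.
  - by rewrite !insubT ?(ltn_trans lt_ab) // => lt_a; apply: (occ _ _).1.
  - by rewrite !insubT !nth_word (occ _ _).2.
rewrite size_word in lt_f.
exists [ffun a : 'I_(size p) => Ordinal (lt_f a (ltn_ord a))].
apply/forallP => a; apply/forallP => b; rewrite !ffunE /= -f_iso //.
rewrite -!nth_word eqxx andbT; apply/implyP => lt_ab.
by rewrite f_mono ?lt_ab /=.
Qed.

Lemma involutionP n (s : 'S_n) :
  reflect (involutive_word (word s)) (involution s).
Proof.
apply: (iffP forallP) => [inv_s|[_ inv_w] i]; last first.
  by apply/eqP/val_inj; have := inv_w i; rewrite size_word !nth_word; apply.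
split=> [|i]; first apply/endo_wordP => i; rewrite size_word => lt_i;
  rewrite -[i]/(val (Ordinal lt_i)) nth_word //.
by rewrite nth_word (eqP (inv_s _)).
Qed.

Lemma word_inv3412 n (s : 'S_n) : inv3412 (word s) <-> s \in I3412 n.
Proof.
rewrite inE; split=> [[inv_w av_w]|/andP[/involutionP inv_w /containsP av_w]].
  by apply/andP; split; [apply/involutionP | apply/containsP => -[f /av_w]].
by split=> // f occ_f; apply: av_w; exists f.
Qed.

Lemma involutive_word_perm (u : seq nat) :
  involutive_word u -> exists s : 'S_(size u), word s = u.
Proof.
move=> [/endo_wordP lt_u inv_u].
pose f (i : 'I_(size u)) := Ordinal (lt_u i (ltn_ord i)).
have f_inj : injective f.
  move=> i j /(congr1 val) /= eq_f; apply: val_inj.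
  by rewrite /= -(inv_u i) // eq_f inv_u.
exists (perm f_inj); apply: (@eq_from_nth _ 0); rewrite size_word // => i lt_i.
by rewrite -[i]/(val (Ordinal lt_i)) nth_word permE.
Qed.

(** * Enumeration by size *)

Definition words n : seq (seq nat) := [seq word s | s in I3412 n].

Lemma mem_words n (u : seq nat) : u \in words n <-> size u = n /\ inv3412 u.
Proof.
split=> [/imageP[s s_in ->]|[<- inv_u]].
  by rewrite size_word; split=> //; apply/word_inv3412.
have [s eq_s] := involutive_word_perm (proj1 inv_u).
by apply/imageP; exists s => //; apply/word_inv3412; rewrite eq_s.
Qed.

Lemma words_uniq n : uniq (words n).
Proof. by rewrite map_inj_uniq ?enum_uniq //; apply: word_inj. Qed.

Lemma words0 : words 0 = [:: [::]].
Proof.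
apply: perm_small_eq => //; apply: uniq_perm => [|//|u].
  exact: words_uniq.
rewrite inE; apply/idP/eqP => [/mem_words[/size0nil]//|->].
by apply/mem_words; split=> //; apply: inv3412_nil.
Qed.

(* The possible first summands, which are the words that start with their last
   position. *)
Definition blocks n : seq (seq nat) :=
  match n with
  | 0 => [::]
  | 1 => [:: [:: 0]]
  | m.+2 => map enclose (words m)
  end.

Lemma mem_blocks n (b : seq nat) : b \in blocks n <->
  [/\ size b = n, 0 < n, inv3412 b & nth 0 b 0 = n.-1].
Proof.
split=> [|[size_b n_gt0 inv_b]].
  case: n => [|[|n]] //=.
    by rewrite inE => /eqP->; split=> //; apply: inv3412_seq1.
  move=> /mapP[u /mem_words[size_u inv_u] ->].
  by rewrite size_enclose /= size_u; split=> //; apply/inv3412_enclose.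
rewrite -size_b in n_gt0 * => /(involutive_exchange_ends (proj1 inv_b) n_gt0).
case=> [->|[u eq_b]]; first by rewrite mem_head.
rewrite eq_b size_enclose map_f //; apply/mem_words; split=> //.
by apply/inv3412_enclose; rewrite -eq_b.
Qed.

Lemma blocks_uniq n : uniq (blocks n).
Proof.
case: n => [|[|n]] //=; rewrite map_inj_uniq ?words_uniq //.
exact: enclose_inj.
Qed.

Definition oplus_words i j : seq (seq nat) :=
  [seq oplus b v | b <- blocks i, v <- words j].

Lemma oplus_words_uniq i j : uniq (oplus_words i j).
Proof.
apply: allpairs_uniq; [exact: blocks_uniq | exact: words_uniq |].
move=> p q /allpairsP[[b u] /= [/mem_blocks[size_b _ _ _] _ ->]].
case/allpairsP=> -[c v] /= [/mem_blocks[size_c _ _ _] _ ->] /= eq_bc.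
by have [|-> ->] := oplus_inj _ eq_bc; rewrite ?size_b.
Qed.

Lemma nth0_oplus_words i j (u : seq nat) :
  u \in oplus_words i j -> i = (nth 0 u 0).+1.
Proof.
case/allpairsP=> -[b v] /= [/mem_blocks[size_b i_gt0 _ b0] _ ->].
by rewrite nth_oplusl ?size_b // b0 prednK.
Qed.

Lemma words_recursion n : perm_eq (words n.+1)
  [seq u | i <- iota 0 n.+2, u <- oplus_words i (n.+1 - i)].
Proof.
apply: uniq_perm; first exact: words_uniq.
  apply: allpairs_uniq_dep => [|i _|];
    [exact: iota_uniq | exact: oplus_words_uniq |].
  move=> p q /allpairsPdep[i [u [_ u_in ->]]].
  case/allpairsPdep=> j [v [_ v_in ->]] /= eq_uv.
  rewrite -{v}eq_uv in v_in *.
  by rewrite (nth0_oplus_words u_in) (nth0_oplus_words v_in).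
move=> u; apply/idP/allpairsPdep => [/mem_words[size_u inv_u]|].
  have [|b [v [eq_u inv_b inv_v b_gt0 b0]]] := inv3412_decomposition inv_u.
    by rewrite size_u.
  have size_bv := size_oplus b v; rewrite -eq_u size_u in size_bv.
  exists (size b), u; split=> //.
    by rewrite mem_iota ltnS size_bv leq_addr.
  rewrite size_bv addKn eq_u; apply/allpairs_f; first exact/mem_blocks.
  exact/mem_words.
case=> i [_ [i_in /allpairsP[[b v] /= [b_in v_in ->]] ->]].
case/mem_blocks: b_in => size_b _ inv_b _; case/mem_words: v_in => size_v inv_v.
rewrite mem_iota ltnS in i_in.
apply/mem_words; rewrite size_oplus size_b size_v subnKC //.
by split=> //; apply/inv3412_oplus; first by case: inv_b => -[].
Qed.

Local Open Scope ring_scope.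

(** * Formal power series *)

Section FpsRing.
Variable R : comNzRingType.
Implicit Types (f g h : fps R) (a b : R).

Lemma fps_coefD f g n : fps_coef (f + g) n = fps_coef f n + fps_coef g n.
Proof. by []. Qed.

Lemma fps_coefB f g n : fps_coef (f - g) n = fps_coef f n - fps_coef g n.
Proof. by []. Qed.

Lemma fps_coef0M f g : fps_coef (f * g) 0 = fps_coef f 0 * fps_coef g 0.
Proof. by rewrite fps_coefM big_ord1. Qed.

Lemma fps_coefCM a f n : fps_coef (fpsC a * f) n = a * fps_coef f n.
Proof.
rewrite fps_coefM big_ord_recl /= subn0 big1 ?addr0 // => i _.
by rewrite mul0r.
Qed.

Lemma fps_coef0XM f : fps_coef (fpsX R * f) 0 = 0.
Proof. by rewrite fps_coef0M mul0r. Qed.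

Lemma fps_coefSXM f n : fps_coef (fpsX R * f) n.+1 = fps_coef f n.
Proof.
rewrite fps_coefM !big_ord_recl /= mul0r add0r mul1r subn1.
by rewrite big1 ?addr0 // => i _; rewrite mul0r.
Qed.

Lemma fps_coefXnM f k n :
  fps_coef (fpsX R ^+ k * f) n = if (n < k)%N then 0 else fps_coef f (n - k).
Proof.
elim: k n => [|k IHk] n; first by rewrite mul1r subn0.
rewrite exprS -mulrA.
by case: n => [|n]; rewrite ?fps_coef0XM // fps_coefSXM IHk.
Qed.

Fact fpsC_is_zmod_morphism : zmod_morphism (@fpsC R).
Proof. by move=> a b; apply/fpsP => -[|n] /=; rewrite ?subr0. Qed.

Fact fpsC_is_monoid_morphism : monoid_morphism (@fpsC R).
Proof.
split=> // a b; apply/fpsP => n; rewrite fps_coefCM.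
by case: n => //= n; rewrite mulr0.
Qed.

HB.instance Definition _ :=
  GRing.isZmodMorphism.Build R (fps R) (@fpsC R) fpsC_is_zmod_morphism.
HB.instance Definition _ :=
  GRing.isMonoidMorphism.Build R (fps R) (@fpsC R) fpsC_is_monoid_morphism.

Definition fps_dilate a f : fps R := Fps (fun n => fps_coef f n * a ^+ n).

Lemma fps_coef_dilate a f n :
  fps_coef (fps_dilate a f) n = fps_coef f n * a ^+ n.
Proof. by []. Qed.

Fact fps_dilate_is_zmod_morphism a : zmod_morphism (fps_dilate a).
Proof. by move=> f g; apply/fpsP => n; rewrite /= mulrBl. Qed.

Fact fps_dilate_is_monoid_morphism a : monoid_morphism (fps_dilate a).
Proof.
split=> [|f g]; apply/fpsP => n.
  by case: n => [|n] /=; rewrite ?mulr1 ?mul0r.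
rewrite [LHS]/= !fps_coefM mulr_suml; apply: eq_bigr => i _ /=.
by rewrite mulrACA -exprD subnKC // -ltnS.
Qed.

HB.instance Definition _ a := GRing.isZmodMorphism.Build (fps R) (fps R)
  (fps_dilate a) (fps_dilate_is_zmod_morphism a).
HB.instance Definition _ a := GRing.isMonoidMorphism.Build (fps R) (fps R)
  (fps_dilate a) (fps_dilate_is_monoid_morphism a).

Lemma fps_dilateX a : fps_dilate a (fpsX R) = fpsX R * fpsC a.
Proof.
by apply/fpsP => -[|[|n]]; rewrite ?fps_coef0XM ?fps_coefSXM /= ?mul0r ?mul1r.
Qed.

Lemma fps_dilateC a b : fps_dilate a (fpsC b) = fpsC b.
Proof. by apply/fpsP => -[|n] /=; rewrite ?mulr1 ?mul0r. Qed.

Lemma fps_dilate_dilate a b f :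
  fps_dilate a (fps_dilate b f) = fps_dilate (a * b) f.
Proof. by apply/fpsP => n; rewrite /= -mulrA exprMn [b ^+ _ * _]mulrC. Qed.

Lemma fps_dilate1 f : fps_dilate 1 f = f.
Proof. by apply/fpsP => n; rewrite /= expr1n mulr1. Qed.

Lemma fps_compXC a f : fps_comp f (fpsX R * fpsC a) = fps_dilate a f.
Proof.
apply/fpsP => n /=; rewrite big_ord_recr big1 /= ?add0r => [|i _];
  rewrite exprMn -rmorphXn fps_coefXnM; first by rewrite ltnn subnn.
by rewrite ltnNge ltnW //= subn_eq0 leqNgt ltn_ord mulr0.
Qed.

Definition fps_eqmodX n f g : Prop :=
  forall k, (k < n)%N -> fps_coef f k = fps_coef g k.

Lemma fps_eqmodXM n f f' g g' :
  fps_eqmodX n f f' -> fps_eqmodX n g g' -> fps_eqmodX n (f * g) (f' * g').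
Proof.
move=> eq_f eq_g k lt_kn; rewrite !fps_coefM; apply: eq_bigr => i _.
by rewrite eq_f ?eq_g // (leq_ltn_trans _ lt_kn) ?leq_subr // -ltnS.
Qed.

Lemma fps_eqmodX_mull n c f g : fps_coef c 0 = 0 ->
  fps_eqmodX n f g -> fps_eqmodX n.+1 (c * f) (c * g).
Proof.
move=> c0 eq_fg k lt_kn; rewrite !fps_coefM !big_ord_recl c0 !mul0r.
congr (_ + _); apply: eq_bigr => i _; rewrite eq_fg // lift0.
by have := ltn_ord i; lia.
Qed.

End FpsRing.

Lemma fps_eqmodXV (R : comUnitRingType) n (f g : fps R) :
    f \is a GRing.unit -> g \is a GRing.unit ->
  fps_eqmodX n f g -> fps_eqmodX n f^-1 g^-1.
Proof.
move=> f_unit g_unit eq_fg k lt_kn.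
rewrite -[f^-1](mulrK g_unit) -[g^-1 in RHS]mul1r -[1 in RHS](mulVr f_unit).
do 2![apply: fps_eqmodXM lt_kn => // {}k lt_kn].
by rewrite eq_fg.
Qed.

Section ContinuedFraction.
Variable R : comUnitRingType.
Variables b c t : nat -> fps R.
Hypothesis coef0_c : forall i, fps_coef (c i) 0 = 0.
Hypothesis t_recursion : forall i, t i * (1 + b i - c i * t i.+1) = 1.

Lemma tail_inverse i : (t i)^-1 = 1 + b i - c i * t i.+1.
Proof. exact: mulr1_eq. Qed.

Lemma tail_unit i : t i \is a GRing.unit.
Proof. by apply/unitrPr; exists (1 + b i - c i * t i.+1). Qed.

Lemma cfrac_den_unit m i : cfrac_den b c m i \is a GRing.unit.
Proof.
have coef0_den g : fps_coef (1 + b i - c i * g) 0 = fps_coef (1 + b i) 0.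
  by rewrite fps_coefB fps_coef0M coef0_c mul0r subr0.
have : (t i)^-1 \is a GRing.unit by rewrite unitrV tail_unit.
rewrite tail_inverse !fps_unitE coef0_den.
by case: m => [//|m]; rewrite -(coef0_den (cfrac_den b c m i.+1)^-1).
Qed.

(* Each level of the fraction multiplies the error by a [c i], which is
   divisible by the variable. *)
Lemma cfrac_den_eqmodX m i : fps_eqmodX m.+1 (cfrac_den b c m i) (t i)^-1.
Proof.
elim: m i => [|m IHm] i k lt_km; rewrite tail_inverse [RHS]fps_coefB.
  by case: k lt_km => // _; rewrite fps_coef0M coef0_c mul0r subr0.
rewrite [LHS]fps_coefB; congr (_ - _); apply: fps_eqmodX_mull lt_km => //.
rewrite -[t _]invrK.
by apply: fps_eqmodXV; rewrite ?unitrV ?cfrac_den_unit ?tail_unit.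
Qed.

Lemma is_cfrac_tails : is_cfrac b c (t 0).
Proof.
split=> [|n]; first exact: cfrac_den_unit.
exists n => m le_nm; rewrite div1r -[t 0]invrK.
apply: (@fps_eqmodXV R m.+1) => //; first exact: cfrac_den_unit.
  by rewrite unitrV tail_unit.
exact: cfrac_den_eqmodX.
Qed.

End ContinuedFraction.

(** * The functional equation *)

Definition weight (u : seq nat) : Zyzw :=
  ypol ^+ word_inv u * zpol ^+ word_des u * wpol ^+ word_fix 0 u.

Definition genfun (C : nat -> seq (seq nat)) : fps Zyzw :=
  Fps (fun n => \sum_(u <- C n) weight u).

Lemma weight_oplus (u v : seq nat) :
  endo_word u -> weight (oplus u v) = weight u * weight v.
Proof.
move=> endo_u; rewrite /weight word_inv_oplus // word_des_oplus //.
by rewrite word_fix_oplus !exprD; ring.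
Qed.

Lemma weight_enclose (u : seq nat) : endo_word u -> weight (enclose u) =
  ypol ^+ (2 * size u + 1) * zpol ^+ (0 < size u).+1 * weight u.
Proof.
move=> endo_u; rewrite /weight word_inv_enclose // word_des_enclose //.
by rewrite word_fix_enclose !exprD; ring.
Qed.

Lemma F_genfun : F = genfun words.
Proof.
apply/fpsP => n /=; rewrite big_image; apply: eq_bigr => s _.
by rewrite /weight word_inv_word word_des_word word_fix_word.
Qed.

Lemma genfun_words_coef0 : fps_coef (genfun words) 0 = 1.
Proof. by rewrite /= words0 big_seq1 /weight !mulr1. Qed.

Lemma genfun_words_recursion :
  genfun words = 1 + genfun blocks * genfun words.
Proof.
apply/fpsP => -[|n].
  rewrite fps_coefD fps_coef0M genfun_words_coef0 [X in X * _]big_nil.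
  by rewrite mul0r addr0.
rewrite fps_coefD add0r fps_coefM [LHS](perm_big _ (words_recursion n)).
rewrite big_allpairs_dep -[iota 0 _]/(index_iota 0 n.+2) big_mkord.
apply: eq_bigr => i _; rewrite big_allpairs_dep mulr_suml.
apply: eq_big_seq => b /mem_blocks[_ _ [[endo_b _] _] _]; rewrite mulr_sumr.
by apply: eq_bigr => v _; rewrite weight_oplus.
Qed.

Lemma genfun_blocks_coef n : fps_coef (genfun blocks) n.+2 =
  ypol ^+ (2 * n + 1) * zpol ^+ (0 < n).+1 * fps_coef (genfun words) n.
Proof.
rewrite /= big_map mulr_sumr; apply: eq_big_seq => u.
case/mem_words=> size_u [[endo_u _] _].
by rewrite weight_enclose // size_u.
Qed.

Lemma genfun_blocksE : genfun blocks =
  x * (w + x * (y * z * (1 + z * (fps_dilate (ypol ^+ 2) (genfun words) - 1)))).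
Proof.
apply/fpsP => -[|[|n]];
  rewrite ?fps_coef0XM ?fps_coefSXM ?fps_coefD ?fps_coef0XM ?fps_coefSXM.
- by rewrite [LHS]big_nil.
- by rewrite [LHS]big_seq1 /weight /= addr0 !mul1r.
rewrite genfun_blocks_coef -[y * z * _]mulrA !fps_coefCM fps_coefD fps_coefCM.
rewrite fps_coefB fps_coef_dilate.
case: n => [|n]; last by rewrite /= -exprM exprD; ring.
by rewrite genfun_words_coef0 muln0 /=; ring.
Qed.

Definition F_dilated i : fps Zyzw := fps_dilate (ypol ^+ (2 * i)) F.

Lemma F_dilated0 : F_dilated 0 = F.
Proof. exact: fps_dilate1. Qed.

Lemma F_dilated1 : F_dilated 1 = fps_comp F (x * y ^+ 2).
Proof. by rewrite /y -rmorphXn fps_compXC. Qed.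

Lemma F_functional_equation :
  F * (1 - x * w - x ^+ 2 * y * z + x ^+ 2 * y * z ^+ 2
       - x ^+ 2 * y * z ^+ 2 * F_dilated 1) = 1.
Proof.
have := genfun_words_recursion.
rewrite genfun_blocksE -F_genfun -/(F_dilated 1).
set B := x * _ => F_rec.
rewrite (_ : _ - _ = 1 - B); last by rewrite /B; ring.
by rewrite mulrBr mulr1 [F * B]mulrC {1}F_rec addrK.
Qed.

Lemma F_dilated_recursion i :
  F_dilated i * (1 + b_ i - c_ i * F_dilated i.+1) = 1.
Proof.
have := congr1 (fps_dilate (ypol ^+ (2 * i))) F_functional_equation.
rewrite !(rmorphM, rmorphB, rmorphD, rmorphN, rmorphXn, rmorph1) /=.
rewrite fps_dilate_dilate -exprD -mulnSr -/(F_dilated i) -/(F_dilated i.+1).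
rewrite !fps_dilateX !fps_dilateC rmorphXn -/x -/y -/z -/w => dilated_eq.
rewrite -[RHS]dilated_eq /b_ /c_.
rewrite (_ : y ^+ (4 * i + 1) = (y ^+ (2 * i)) ^+ 2 * y).
  by move: (y ^+ _) (F_dilated _) (F_dilated _) => p f g; ring.
by rewrite -exprM -exprSr; congr (_ ^+ _); lia.
Qed.

Lemma c_coef0 i : fps_coef (c_ i) 0 = 0.
Proof. by rewrite /c_ expr2 -!mulrA fps_coef0XM. Qed.

Theorem theorem3p4 :
  F = 1 / (1 - x * w - x ^+ 2 * y * z + x ^+ 2 * y * z ^+ 2
           - x ^+ 2 * y * z ^+ 2 * fps_comp F (x * y ^+ 2))
  /\ is_cfrac b_ c_ F.
Proof.
split.
  rewrite -F_dilated1 div1r; apply/esym/mulr1_eq.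
  by rewrite mulrC; apply: F_functional_equation.
by rewrite -F_dilated0; apply: is_cfrac_tails c_coef0 F_dilated_recursion.
Qed.
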